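(* Let $P$ be a set of $n$ points on a line $\ell$, let $\mathcal{I}$ be the set of intervals of $\ell$, and let $H=H(P,\mathcal{I})$. Then $\chi^2_{CF}(H^{\cup})\le 4\log n$.
   Context: $H(P,\mathcal{I})$ is the hypergraph with vertex set $P$ and hyperedges $I\cap P$ for $I\in\mathcal{I}$. For a hypergraph $H=(V,\mathcal{E})$, $H^{\cup}=(V,\{e\cup f: e,f\in\mathcal{E}\})$. A $2$-subset-CF-colouring of a hypergraph $(V,\mathcal{F})$ with $k$ colours is a function $\varphi$ from the $2$-element subsets of $V$ to a $k$-element set such that every $h\in\mathcal{F}$ with $|h|>2$ contains a pair $s\subseteq h$ whose colour differs from the colours of all other pairs in $h$; $\chi^2_{CF}$ is the least such $k$. Here $\log$ denotes the binary logarithm. *)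

(* Defs.v *)
From mathcomp Require Import all_boot all_order all_algebra finmap.
From mathcomp Require Import boolp classical_sets reals topology normedtype exp.

Set Implicit Arguments.
Unset Strict Implicit.
Unset Printing Implicit Defensive.

(* A hypergraph is given by its finite vertex type [V] and its set of          *)
(* hyperedges, of type [{set {set V}}]. A hyperedge may be empty.              *)

Section Hypergraphs.
Variable V : finType.

Definition hunion (E : {set {set V}}) : {set {set V}} :=
  [set (e :|: f)%SET | e in E, f in E].

(* The domain of colourings is a genuine subtype, so that the empty palette    *)
(* ['I_0] is usable exactly when [V] has fewer than two elements.              *)
Definition vpair : Type := {s : {set V} | #|s| == 2}.

Definition is_subset2_CF (E : {set {set V}}) (k : nat)
    (phi : {ffun vpair -> 'I_k}) : bool :=
  [forall h in E, (2 < #|h|) ==>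
    [exists s : vpair, (val s \subset h) &&
      [forall t : vpair, (val t \subset h) && (t != s) ==> (phi t != phi s)]]].

Definition subset2_CF_colourable (E : {set {set V}}) (k : nat) : bool :=
  [exists phi : {ffun vpair -> 'I_k}, is_subset2_CF E phi].

Lemma subset2_CF_colourable_ex (E : {set {set V}}) :
  exists k, subset2_CF_colourable E k.
Proof.
exists #|{: vpair}|; apply/existsP; exists [ffun s => enum_rank s].
apply/forall_inP => h _; apply/implyP => h_gt2.
have /card_gt1P[x [y [xh yh xy]]] : 1 < #|h| by apply: leq_trans h_gt2.
have xyP : #|[set x; y]%SET| == 2 by rewrite cards2 xy.
apply/existsP; exists (exist (fun s : {set V} => is_true (#|s| == 2)) _ xyP); apply/andP; split.
  by rewrite /=; apply/fintype.subsetP => z /set2P[] ->.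
apply/forallP => t; apply/implyP => /andP[_ nts].
by rewrite !ffunE (inj_eq enum_rank_inj).
Qed.

Definition chi2_CF (E : {set {set V}}) : nat :=
  ex_minn (subset2_CF_colourable_ex E).

End Hypergraphs.

(* [induced P I] is H(P, I); its vertex type is [P], seen as a finite type.    *)
Definition induced (T : choiceType) (P : {fset T}) (I : set (set T)) :
    {set {set P}} :=
  [set e : {set P} |
    `[< exists2 A : set T, I A & e = [set p : P | `[< A (val p) >] ]%SET >] ]%SET.

(* The line is identified with [R]; an interval is a convex subset of it, so   *)
(* bounded or not, with or without its endpoints, possibly empty.              *)
Definition intervals (R : realType) : set (set R) :=
  [set A : set R | is_interval A]%classic.

(* As [ln 0 = 0] in the library, [log2 0 = 0]. *)
Definition log2 (R : realType) (x : R) : R := (ln x / ln 2)%R.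

(* Main.v *)
(* Number the points 1, ..., n along the line and let the level of a point be
   the 2-adic valuation of its number.  A consecutive pair {i, i+1} gets the
   colour (1, level i), a pair of points of the same level l the colour (2, l),
   and all remaining pairs share one more colour.  Given h = I u J with |h| > 2,
   let l be the largest level of an i with i, i+1 in h.  Between two points of
   level l there is one of higher level, so neither I nor J contains two points
   of level l.  If h has two such points they form the only pair of colour
   (2, l); otherwise the pair {i, i+1} realising l is the only one of colour
   (1, l).  With t = floor(log2(n - 1)) this takes at most 2t + 4 colours, and
   2^(2t+4) <= n^4 because 16 x^2 <= (x + 1)^4. *)
Require Import Defs.
From mathcomp Require Import all_boot all_order all_algebra finmap.
From mathcomp Require Import boolp classical_sets reals topology normedtype exp.
From mathcomp Require Import zify.

Set Implicit Arguments.
Unset Strict Implicit.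
Unset Printing Implicit Defensive.

Import GRing.Theory Num.Theory.

(** * Levels (2-adic valuations) of integers *)

Lemma logn2_between p q : 0 < p < q -> logn 2 p = logn 2 q ->
  exists2 m, p < m < q & logn 2 p < logn 2 m.
Proof.
move=> /andP[p0 pq] pqE.
have [a a2 pE] := pfactor_coprime (isT : prime 2) p0.
have [b b2 qE] := pfactor_coprime (isT : prime 2) (ltn_trans p0 pq).
move: a2 b2; rewrite !coprime2n => a2 b2.
rewrite -pqE in qE; set v := logn 2 p in pE qE *.
have ab : a < b by move: pq; rewrite pE qE ltn_pmul2r ?expn_gt0.
have v0 : 0 < 2 ^ v by rewrite expn_gt0.
(* Here [p = a * 2 ^ v] and [q = b * 2 ^ v] with [a < b] both odd, so the even number [a.+1] lies
   strictly between [a] and [b]. *)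
exists (a.+1 * 2 ^ v).
  rewrite pE qE !ltn_pmul2r // ltnSn ltn_neqAle ab andbT.
  by apply/eqP => abE; move: b2; rewrite -abE /= a2.
rewrite -pfactor_dvdn ?muln_gt0 // expnS dvdn_pmul2r //.
by rewrite dvdn2 /= a2.
Qed.

(** * The colouring of ranked points *)

Section RankColouring.
Variables (V : finType) (n : nat) (r : V -> nat).
Hypotheses (r_inj : injective r) (r_gt0 : forall x, 0 < r x).
Hypothesis r_le : forall x, r x <= n.

(** Intermediate ranks must actually be attained in [A]: this supplies both neighbouring points and
    points of higher level. *)
Definition rank_convex (A : {set V}) :=
  forall x y m, x \in A -> y \in A -> r x <= m <= r y ->
  exists2 z, z \in A & r z = m.

Definition max_rank (s : {set V}) := \max_(x in s) r x.
(* On a pair, this is the smaller of the two ranks. *)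
Definition min_rank (s : {set V}) := \sum_(x in s) r x - max_rank s.

(** The lower point of a pair has rank at most [n.-1], which bounds every level used in a colour. *)
Definition top_level := trunc_log 2 n.-1.

(** Colour (1, l) is encoded as 2l, colour (2, l) as 2l + 1, and the shared colour is the first even
    number above all of these. *)
Definition pair_colour (s : {set V}) : nat :=
  let i := min_rank s in let j := max_rank s in
  if j == i.+1 then (logn 2 i).*2
  else if logn 2 j == logn 2 i then (logn 2 i).*2.+1
  else top_level.+1.*2.

Lemma pair_colourE x y : r x < r y -> pair_colour [set x; y] =
  if r y == (r x).+1 then (logn 2 (r x)).*2
  else if logn 2 (r y) == logn 2 (r x) then (logn 2 (r x)).*2.+1
  else top_level.+1.*2.
Proof.
move=> xy.
have xNy : x \notin [set y] by rewrite inE; apply: contraTneq xy => ->; rewrite ltnn.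
have maxE : max_rank [set x; y] = r y.
  by rewrite /max_rank big_setU1 //= big_set1; apply/maxn_idPr/ltnW.
have minE : min_rank [set x; y] = r x.
  by rewrite /min_rank maxE big_setU1 //= big_set1 addnK.
by rewrite /pair_colour maxE minE.
Qed.

Lemma vpairP (s : vpair V) : exists x y, r x < r y /\ val s = [set x; y].
Proof.
have /cards2P[x [y [xy sE]]] := valP s.
case: (ltngtP (r x) (r y)) => [lt|lt|/r_inj eq].
- by exists x, y.
- by exists y, x; rewrite finset.setUC.
- by rewrite eq eqxx in xy.
Qed.

Lemma logn2_rank_top x y : r x < r y -> logn 2 (r x) <= top_level.
Proof.
move=> xy; apply: trunc_log_max => //.
apply: leq_trans (dvdn_leq (r_gt0 x) (pfactor_dvdnn 2 (r x))) _.
by have := r_le y; lia.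
Qed.

Lemma pair_colour_lt (s : vpair V) : pair_colour (val s) < top_level.+2.*2.
Proof.
have [x [y [xy ->]]] := vpairP s; rewrite pair_colourE //.
by have := logn2_rank_top xy; case: ifP => _; last case: ifP => _; lia.
Qed.

Lemma rank_convex_consecutive (A : {set V}) : rank_convex A -> 1 < #|A| ->
  exists x y, [/\ x \in A, y \in A & r y = (r x).+1].
Proof.
move=> cA /card_gt1P[x [y [xA yA xy]]].
wlog lt : x y xA yA xy / r x < r y.
  move=> wl; case: (ltngtP (r x) (r y)) => [|lt|/r_inj eq]; first exact: wl.
    by apply: (wl y x) => //; rewrite eq_sym.
  by rewrite eq eqxx in xy.
have [z zA zE] := cA x y (r x).+1 xA yA ltac:(lia).
by exists x, z.
Qed.

Section Union.
Variables e f : {set V}.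
Hypotheses (ce : rank_convex e) (cf : rank_convex f) (ef2 : 2 < #|e :|: f|).

(** By pigeonhole, one of [e] and [f] has two points. *)
Lemma union_consecutive :
  exists x y, [/\ x \in e :|: f, y \in e :|: f & r y = (r x).+1].
Proof.
have [e1|e1] := ltnP 1 #|e|.
  have [x [y [xe ye xy]]] := rank_convex_consecutive ce e1.
  by exists x, y; rewrite !inE xe ye.
have f1 : 1 < #|f| by have := (leq_card_setU e f).1; have := ef2; lia.
have [x [y [xf yf xy]]] := rank_convex_consecutive cf f1.
by exists x, y; rewrite !inE xf yf !orbT.
Qed.

Lemma union_unique_pair : exists2 s : vpair V, val s \subset e :|: f &
  forall t : vpair V, val t \subset e :|: f ->
    pair_colour (val t) = pair_colour (val s) -> t = s.
Proof.
pose h := e :|: f.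
pose E := [pred x | (x \in h) && [exists y in h, r y == (r x).+1]].
have [x [y [[xh yh xyE] xmax]]] : exists x y, [/\ x \in h, y \in h & r y = (r x).+1] /\
    (forall z, E z -> logn 2 (r z) <= logn 2 (r x)).
  have [x0 [y0 [xh0 yh0 xy0]]] := union_consecutive.
  have Ex0 : E x0 by rewrite /E /= /h xh0; apply/exists_inP; exists y0; rewrite ?xy0.
  case: (@arg_maxnP _ x0 E (fun z => logn 2 (r z)) Ex0) => x.
  move=> /andP[xh /exists_inP[y yh /eqP xy]] xmax.
  by exists x, y.
pose l := logn 2 (r x).
(* Otherwise some [m] of higher level lies strictly between the two ranks. As [m.+1] is still at
   most [r b], the points of ranks [m] and [m.+1] lie in [h], against the maximality of [l]. *)
have uniq_level (A : {set V}) a b : rank_convex A -> A \subset h ->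
    a \in A -> b \in A -> logn 2 (r a) = l -> logn 2 (r b) = l -> a = b.
  move=> cA Ah; wlog lt : a b / r a < r b.
    move=> wl aA bA al bl; case: (ltngtP (r a) (r b)) => [lt|lt|/r_inj //].
      exact: wl.
    by apply/esym/wl.
  move=> aA bA al bl.
  have [|m /andP[am mb]] := @logn2_between (r a) (r b) _ (etrans al (esym bl)).
    by rewrite r_gt0.
  have [u uA uE] := cA a b m aA bA ltac:(lia).
  have [w wA wE] := cA a b m.+1 aA bA ltac:(lia).
  rewrite al -uE ltnNge xmax //= (fintype.subsetP Ah) //=.
  by apply/exists_inP; exists w; rewrite ?(fintype.subsetP Ah) // wE uE.
have eh : e \subset h by apply: finset.subsetUl.
have fh : f \subset h by apply: finset.subsetUr.
have mk a b : r a < r b -> exists s : vpair V, val s = [set a; b].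
  move=> ab; have ab2 : #|[set a; b]| == 2.
    by rewrite cards2; case: (a =P b) ab => [->|//]; rewrite ltnn.
  by exists (exist (fun s : {set V} => #|s| == 2) _ ab2).
have [[p [q [ph qh pq pl ql]]]|noq] := pselect (exists p q,
    [/\ p \in h, q \in h, r p < r q, logn 2 (r p) = l & logn 2 (r q) = l]).
  (* Nothing lies strictly between consecutive ranks, so they cannot share a level; hence the pair
     gets the odd colour 2l + 1, and parity excludes the other two kinds of pairs. *)
  have qNSp : (r q == (r p).+1) = false.
    apply/eqP => qE; have [||m] := @logn2_between (r p) (r q).
    - by rewrite r_gt0.
    - by rewrite pl ql.
    - by rewrite qE; lia.
  have [s sE] := mk _ _ pq; exists s; rewrite sE.
    by apply/fintype.subsetP => z /set2P[] ->.
  move=> t; have [a [b [ab tE]]] := vpairP t; rewrite tE => sub.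
  have ah : a \in h by apply: (fintype.subsetP sub); rewrite !inE eqxx.
  have bh : b \in h by apply: (fintype.subsetP sub); rewrite !inE eqxx orbT.
  rewrite !pair_colourE // qNSp ql pl eqxx.
  case: ifP => _; first by lia.
  case: ifP => [/eqP abl al|_]; last by lia.
  have {}al : logn 2 (r a) = l by lia.
  rewrite al in abl.
  apply/val_inj; rewrite tE sE.
  have Ue c d ce' de' := uniq_level e c d ce eh ce' de'.
  have Uf c d cf' df' := uniq_level f c d cf fh cf' df'.
  have neq c d : r c < r d -> c <> d by move=> + cd; rewrite cd ltnn.
  (* Neither [e] nor [f] holds two points of level [l], so each holds exactly one of [p], [q] and
     one of [a], [b]; these must coincide. *)
  case/setUP: ph => ph; case/setUP: qh => qh; case/setUP: ah => ah;
  case/setUP: bh => bh;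
  try (by case: (neq _ _ pq); auto); try (by case: (neq _ _ ab); auto).
  - by rewrite (Ue a p) // (Uf b q).
  - by rewrite (Uf a q) // (Ue b p) // finset.setUC.
  - by rewrite (Ue a q) // (Uf b p) // finset.setUC.
  - by rewrite (Uf a p) // (Ue b q).
have xy : r x < r y by rewrite xyE.
have [s sE] := mk _ _ xy; exists s; rewrite sE.
  by apply/fintype.subsetP => z /set2P[] ->.
move=> t; have [a [b [ab tE]]] := vpairP t; rewrite tE => sub.
have ah : a \in h by apply: (fintype.subsetP sub); rewrite !inE eqxx.
have bh : b \in h by apply: (fintype.subsetP sub); rewrite !inE eqxx orbT.
(* This keeps the even colour 2l of the pair below the shared even colour. *)
have lx := logn2_rank_top xy.
rewrite !pair_colourE // xyE eqxx.
case: ifP => [/eqP bE al|_]; last by case: ifP => _; lia.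
have {}al : logn 2 (r a) = l by rewrite /l; lia.
apply/val_inj; rewrite tE sE.
(* Both points have level [l], and the present case allows only one such point in [h]. *)
have ax : a = x.
  case: (ltngtP (r a) (r x)) => [lt|lt|/r_inj //]; case: noq.
    by exists a, x.
  by exists x, a.
by rewrite ax in bE *; rewrite (r_inj (etrans bE (esym xyE))).
Qed.

End Union.

Lemma hunion_colourable (E : {set {set V}}) :
  (forall e, e \in E -> rank_convex e) ->
  subset2_CF_colourable (hunion E) top_level.+2.*2.
Proof.
move=> cE; apply/existsP; exists [ffun s => Ordinal (pair_colour_lt s)].
apply/forall_inP => _ /imset2P[e f eE fE ->]; apply/implyP => ef2.
have [s sh s_uniq] := union_unique_pair (cE e eE) (cE f fE) ef2.
apply/existsP; exists s; rewrite sh /=; apply/forallP => t.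
apply/implyP => /andP[th]; apply: contraNneq; rewrite !ffunE => -[] /s_uniq ->//.
Qed.

End RankColouring.

(** * Bounds on the chromatic number *)

Lemma chi2_CF_le (V : finType) (E : {set {set V}}) k :
  subset2_CF_colourable E k -> chi2_CF E <= k.
Proof. by rewrite /chi2_CF; case: ex_minnP => m _; apply. Qed.

Lemma subset2_CF_colourable0 (V : finType) (E : {set {set V}}) :
  #|V| <= 1 -> subset2_CF_colourable E 0.
Proof.
move=> V1.
have card_le1 (A : {set V}) : #|A| <= 1 by apply: leq_trans (max_card _) V1.
have no_pair (s : vpair V) : False by have := card_le1 (val s); rewrite (eqP (valP s)).
apply/existsP; exists [ffun s => False_rect _ (no_pair s)].
apply/forall_inP => h _; apply/implyP => h2; have := card_le1 h; lia.
Qed.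

(** * Ranks of points on the line *)

Section Line.
Variables (R : realType) (P : {fset R}).

(** The point itself is counted, so ranks start at 1 and valuations are meaningful. *)
Definition line_rank (x : P) := #|[set y : P | (val y <= val x)%O]|.

Lemma line_rank_mono x y : (line_rank x < line_rank y) = (val x < val y)%O.
Proof.
have le a b : (val a <= val b)%O -> line_rank a <= line_rank b.
  move=> ab; apply/subset_leq_card/fintype.subsetP => z; rewrite !inE => za.
  exact: Order.POrderTheory.le_trans za ab.
case: (Order.TotalTheory.leP (val y) (val x)) => [/le|xy]; first by rewrite ltnNge => ->.
apply/proper_card/properP; split.
  apply/fintype.subsetP => z; rewrite !inE => zx.
  exact: Order.POrderTheory.le_trans zx (Order.POrderTheory.ltW xy).
exists y; first by rewrite inE Order.POrderTheory.lexx.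
by rewrite inE -Order.TotalTheory.ltNge.
Qed.

Lemma line_rank_le x y : (line_rank x <= line_rank y) = (val x <= val y)%O.
Proof. by rewrite leqNgt line_rank_mono -Order.TotalTheory.leNgt. Qed.

Lemma line_rank_inj : injective line_rank.
Proof.
move=> x y xy; apply/val_inj/Order.POrderTheory.le_anti.
by rewrite -!line_rank_le xy leqnn.
Qed.

Lemma line_rank_gt0 x : 0 < line_rank x.
Proof. by apply/card_gt0P; exists x; rewrite inE Order.POrderTheory.lexx. Qed.

Lemma line_rank_max x : line_rank x <= #|{: P}|.
Proof. exact: max_card. Qed.

Lemma line_rank_onto m : 0 < m <= #|{: P}| -> exists x, line_rank x = m.
Proof.
move=> m_bd.
have lt x : (line_rank x).-1 < #|{: P}|.
  by have := line_rank_gt0 x; have := line_rank_max x; lia.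
pose g x := Ordinal (lt x).
have g_inj : injective g.
  move=> x y [] xy; apply: line_rank_inj.
  by have := line_rank_gt0 x; have := line_rank_gt0 y; lia.
have mP : m.-1 < #|{: P}| by lia.
(* An injection between finite sets of equal size is onto. *)
have /codomP[x /(congr1 val) /= xE] : Ordinal mP \in codom g.
  by apply: inj_card_onto => //; rewrite card_ord.
by exists x; have := line_rank_gt0 x; lia.
Qed.

Lemma induced_interval_convex e :
  e \in induced P (@intervals R) -> rank_convex line_rank e.
Proof.
rewrite inE => /asboolP[A itvA ->] x y m.
rewrite !finset.inE => /asboolP Ax /asboolP Ay /andP[xm my].
have [|z zE] := @line_rank_onto m.
  by have := line_rank_gt0 x; have := line_rank_max y; lia.
exists z => //; rewrite inE; apply/asboolP; apply: (itvA _ _ Ax Ay (val z)).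
apply/andP; split.
  by rewrite -line_rank_le zE.
by rewrite -line_rank_le zE.
Qed.

End Line.

(** * Comparison with the logarithm *)

Lemma double_trunc_log2_le (R : realType) n : 1 < n ->
  (((trunc_log 2 n.-1).+2.*2)%:R <= 4 * log2 (n%:R : R))%R.
Proof.
move=> n1; set t := trunc_log 2 n.-1.
have tn : 2 ^ t < n by have := @trunc_logP 2 n.-1 isT ltac:(lia); rewrite -/t; lia.
have pow_le : 2 ^ t.+2.*2 <= n ^ 4.
  have -> : 2 ^ t.+2.*2 = (4 * 2 ^ t) ^ 2.
    by rewrite -muln2 expnM (expnD 2 2).
  rewrite (expnM n 2 2 : n ^ 4 = _) leq_exp2r //.
  apply: leq_trans (_ : (2 ^ t).+1 ^ 2 <= _); last by rewrite leq_exp2r.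
  (* With x = [2 ^ t], this is 4x <= (x + 1)^2, which follows from 2x <= x^2 + 1. *)
  by have := nat_Cauchy (2 ^ t) 1; nia.
have ln2_gt0 : (0 < ln (2 : R))%R by apply: ln_gt0; rewrite ltr1n.
rewrite /log2 mulrA ler_pdivlMr //.
have n_gt0 : (0 < n%:R :> R)%R by rewrite ltr0n; lia.
have -> : (4 * ln (n%:R : R) = ln ((n ^ 4)%:R : R))%R.
  by rewrite natrX lnXn // mulr_natl.
rewrite mulr_natl -lnXn // -natrX ler_ln ?posrE ?ltr0n ?expn_gt0 ?ler_nat //.
by lia.
Qed.

Theorem theorem5p1 (R : realType) (n : nat) (P : {fset R}) (hP : #|` P|%fset = n) :
  ((chi2_CF (hunion (induced P (@intervals R))))%:R <= 4 * log2 (n%:R : R))%R.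
Proof.
have cardP : #|{: P}| = n by rewrite -hP cardfE.
have [n1|n1] := ltnP 1 n.
  apply: Order.POrderTheory.le_trans (double_trunc_log2_le R n1).
  rewrite ler_nat; apply: chi2_CF_le; rewrite -cardP.
  apply: (hunion_colourable (@line_rank_inj R P) (@line_rank_gt0 R P)).
    exact: line_rank_max.
  exact: induced_interval_convex.
have /chi2_CF_le : subset2_CF_colourable (hunion (induced P (@intervals R))) 0.
  by apply: subset2_CF_colourable0; rewrite cardP.
rewrite leqn0 => /eqP ->.
(* For [n = 0] this rests on the default value [ln 0 = 0]. *)
have -> : (log2 (n%:R : R) = 0)%R.
  rewrite /log2; case: n n1 {hP cardP} => [|[|]] // _.
    by rewrite ln0 ?mul0r.
  by rewrite ln1 mul0r.
by rewrite mulr0.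
Qed.
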